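(* Let $N$ be a unitarily invariant norm on $M_n(\mathbb{C})$, let $A\in M_n(\mathbb{C})$ be positive definite and let $X\in M_n(\mathbb{C})$. Then, for each of the two choices of sign $\pm$ (the same sign being taken on both sides of each inequality), $$w_N\big(A^{t}XA^{1-t}\pm A^{1-t}XA^{t}\big)\le w_N(AX\pm XA)\quad\text{if } t\in[0,1],$$ $$w_N\big(A^{t}XA^{1-t}\pm A^{1-t}XA^{t}\big)\ge w_N(AX\pm XA)\quad\text{if } t\in\mathbb{R}\setminus[0,1].$$
   Context: For a norm $N$ on $M_n(\mathbb{C})$ (the $n\times n$ complex matrices), the generalized numerical radius of $Y\in M_n(\mathbb{C})$ is $w_N(Y)=\sup_{\theta\in\mathbb{R}}N(\mathrm{Re}(e^{i\theta}Y))$, where $\mathrm{Re}(Z)=\frac12(Z+Z^* )$. The norm $N$ is unitarily invariant if $N(UYV)=N(Y)$ for all $Y\in M_n(\mathbb{C})$ and all unitary $U,V\in M_n(\mathbb{C})$. For a positive definite (Hermitian) matrix $A$ and $t\in\mathbb{R}$, $A^t$ is defined by the functional calculus. *)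

(* Defs.v *)
From mathcomp Require Import all_boot all_order all_algebra.
From mathcomp Require Import spectral sesquilinear complex.
From mathcomp Require Import mathcomp_extra boolp classical_sets reals.
From mathcomp Require Import exp trigo.

Set Implicit Arguments.
Unset Strict Implicit.
Unset Printing Implicit Defensive.

Import Order.TTheory GRing.Theory Num.Theory.
Local Open Scope ring_scope.
Local Open Scope classical_set_scope.
Local Open Scope complex_scope.
Local Open Scope sesquilinear_scope.

Section Definitions.
Context {R : realType} {n : nat}.
Implicit Types (N : 'M[R[i]]_n -> R) (A X Y : 'M[R[i]]_n).

(* [`|c|] is the modulus of [c], which the library types in [R[i]]. *)
Definition is_norm N : Prop :=
  [/\ forall X, 0 <= N X,
      forall X, N X = 0 -> X = 0,
      forall (c : R[i]) X, (N (c *: X))%:C = `|c| * (N X)%:C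
    & forall X Y, N (X + Y) <= N X + N Y].

Definition unitarily_invariant N : Prop :=
  forall Y U V, U \is unitarymx -> V \is unitarymx -> N (U *m Y *m V) = N Y.

Definition mxRe Y : 'M[R[i]]_n := 2^-1 *: (Y + Y ^t*).

Definition expi (theta : R) : R[i] := cos theta +i* sin theta.

(* For a norm the set below is nonempty and bounded (see
   [gen_num_radius_has_sup]), so that [sup] is the genuine supremum. *)
Definition gen_num_radius N Y : R :=
  sup [set N (mxRe (expi theta *: Y)) | theta in [set: R]].

Definition posdefmx A : Prop :=
  A \is hermsymmx /\
  forall v : 'cV[R[i]]_n, v != 0 -> 0 < (v ^t* *m A *m v) 0 0.

(* Functional calculus of a Hermitian [A]: [f] is applied to the eigenvalues in
   the unitary diagonalization
   [A = invmx (spectralmx A) *m diag_mx (spectral_diag A) *m spectralmx A];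
   these are real, so that taking [complex.Re] loses nothing. *)
Definition herm_fun (f : R -> R) A : 'M[R[i]]_n :=
  invmx (spectralmx A) *m
  diag_mx (map_mx (fun z : R[i] => (f (complex.Re z))%:C) (spectral_diag A)) *m
  spectralmx A.

Definition mxpowR A (t : R) : 'M[R[i]]_n := herm_fun (fun x => x `^ t) A.

Lemma gen_num_radius_has_sup N Y : is_norm N ->
  has_sup [set N (mxRe (expi theta *: Y)) | theta in [set: R]].
Proof.
case=> N0 _ NZ ND.
have NZr (c : R[i]) X : N (c *: X) = complex.Re `|c| * N X.
  have /(congr1 (@complex.Re R)) := NZ c X.
  by rewrite normc_def /= mul0r subr0.
have cn (c : R[i]) : 0 <= complex.Re `|c| :> R by rewrite normc_def /= sqrtr_ge0.
have en th : complex.Re `|expi th| = 1 :> R.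
  by rewrite normc_def /= cos2Dsin2 sqrtr1.
split; first by exists (N (mxRe (expi 0 *: Y))); exists 0.
exists (complex.Re `|2^-1 : R[i]| * (N Y + N (Y ^t*))) => _ [th _ <-].
rewrite /mxRe NZr ler_wpM2l //; apply: le_trans (ND _ _) _.
rewrite NZr en mul1r lerD2l.
have -> : (expi th *: Y) ^t* = (expi th)^* %R *: Y ^t*.
  by apply/matrixP => i j; rewrite !mxE rmorphM.
by rewrite NZr norm_conjC en mul1r.
Qed.

Lemma herm_fun_id A : A \is hermsymmx -> herm_fun id A = A.
Proof.
move=> hA; rewrite [RHS](orthomx_spectralP (hermitian_normalmx hA)).
rewrite /herm_fun; congr (_ *m diag_mx _ *m _).
have /mxOverP rd := hermitian_spectral_diag_real hA.
apply/matrixP => i j; rewrite mxE; apply/esym/eqP.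
by rewrite eq_complex /= eqxx; have /complex_realP[x ->] /= := rd i j.
Qed.

End Definitions.

(* Main.v *)
Require Import Defs.
From mathcomp Require Import all_boot all_order all_algebra fingroup perm.
From mathcomp Require Import spectral sesquilinear complex.
From mathcomp Require Import reals exp.
From mathcomp Require Import ring lra.

(** Taking real parts turns the two sides, for each angle [theta], into
  [F t = A^t K A^(1-t) + r A^(1-t) K A^t] with [r = 1] or [r = -1] and
  [K^* = r K], so that [F t] is Hermitian.  Since
  [F (t + u) + F (t - u) = A^u (F t) A^(-u) + A^(-u) (F t) A^u], the inequality
  [2 N(Y) <= N(B Y B^-1 + B^-1 Y B)] for Hermitian [Y] and [B] makes [N (F t)]
  midpoint convex in [t].  It is also symmetric about [1/2] and locally bounded,
  hence nondecreasing in [|2 t - 1|]. *)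

Set Implicit Arguments.
Unset Strict Implicit.
Unset Printing Implicit Defensive.

Import Order.TTheory GRing.Theory Num.Theory.
Local Open Scope ring_scope.
Local Open Scope sesquilinear_scope.

(** By evenness take [x >= 0]; then [x] is the midpoint of [r] and [2 * x - r], so an excess of
    [g x] over [g r] at least doubles at [2 * x - r], which stays in [[-r, r]]. Iterating from a
    positive excess contradicts the bound [M]. *)
Lemma even_midconvex_le (R : archiRealFieldType) (g : R -> R) (r M : R) :
  (forall s, g (- s) = g s) ->
  (forall s u, 2 * g s <= g (s + u) + g (s - u)) ->
  (forall s, `|s| <= r -> g s <= M) ->
  forall s, `|s| <= r -> g s <= g r.
Proof.
move=> gN gconv gM s sr; rewrite leNgt; apply/negP => grs.
have step (x : R) : `|x| <= r ->
    exists2 y, `|y| <= r & 2 * (g x - g r) <= g y - g r.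
  move=> xr; exists (2 * `|x| - r).
    by rewrite ler_norml; have := normr_ge0 x; lra.
  have -> : g x = g `|x| by case: (ger0P x) => _ //; rewrite gN.
  have := gconv `|x| (r - `|x|).
  have -> : `|x| + (r - `|x|) = r by ring.
  have -> : `|x| - (r - `|x|) = 2 * `|x| - r by ring.
  lra.
have iterate k : exists2 y, `|y| <= r & 2 ^+ k * (g s - g r) <= g y - g r.
  elim: k => [|k [y yr IH]]; first by exists s => //; rewrite expr0 mul1r.
  have [z zr yz] := step y yr; exists z => //; apply: le_trans yz.
  by rewrite exprS -mulrA ler_pM2l.
have d0 : 0 < g s - g r by rewrite subr_gt0.
(* [k] exceeds the ratio of the largest possible excess to the initial one, and [2 ^ k > k]. *)
pose k := Num.bound ((M - g r) / (g s - g r)).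
have [y yr] := iterate k; apply/negP; rewrite -ltNge.
apply: le_lt_trans (_ : M - g r < _); first by rewrite lerD2r gM.
rewrite -ltr_pdivrMr //; apply: (@lt_le_trans _ _ k%:R).
  apply: archi_boundP; apply: divr_ge0; last exact: ltW.
  by rewrite subr_ge0; apply: le_trans (gM s sr); apply: ltW.
by rewrite -natrX ler_nat ltnW // ltn_expl.
Qed.

Lemma char_poly_conj (F : fieldType) n (P A : 'M[F]_n) : P \in unitmx ->
  char_poly (P *m A *m invmx P) = char_poly A.
Proof.
move=> uP; rewrite /char_poly /char_poly_mx.
have -> : 'X%:M - map_mx polyC (P *m A *m invmx P)
    = map_mx polyC P *m ('X%:M - map_mx polyC A) *m map_mx polyC (invmx P).
  rewrite mulmxBr mulmxBl scalar_mxC -['X%:M *m _ *m _]mulmxA -map_mxM mulmxV //.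
  by rewrite map_mx1 mulmx1 !map_mxM.
by rewrite !det_mulmx mulrAC -det_mulmx -map_mxM mulmxV // map_mx1 det1 mul1r.
Qed.

(** * Adjoints and symmetrized two-sided products *)

Section ConjugateTranspose.
Context {C : numClosedFieldType} {n : nat}.
Implicit Types (P X Y Z : 'M[C]_n).

Lemma trmxC_mul X Y : (X *m Y) ^t* = Y ^t* *m X ^t*.
Proof. by rewrite trmx_mul map_mxM. Qed.

Lemma trmxCD X Y : (X + Y) ^t* = X ^t* + Y ^t*.
Proof. by rewrite linearD map_mxD. Qed.

Lemma trmxCZ (c : C) X : (c *: X) ^t* = c^* *: X ^t*.
Proof. by rewrite linearZ map_mxZ. Qed.

Lemma trmxC_conj P X : (P ^t* *m X *m P) ^t* = P ^t* *m X ^t* *m P.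
Proof. by rewrite !trmxC_mul trmxCK mulmxA. Qed.

Lemma unitary_conjM P X Y : P \is unitarymx ->
  (P ^t* *m X *m P) *m (P ^t* *m Y *m P) = P ^t* *m (X *m Y) *m P.
Proof. by move=> hP; rewrite !mulmxA mulmxtVK. Qed.

(** For [r = 1] this [K] is the Hermitian part of [Y], for [r = -1] the skew-Hermitian part. *)
Lemma half_addZ_trmxC r Y (K := 2^-1 *: (Y + r *: Y ^t*)) :
  r * r = 1 -> r^* = r -> K ^t* = r *: K.
Proof.
move=> rr hr; rewrite /K trmxCZ trmxCD trmxCZ trmxCK hr fmorphV rmorph_nat.
rewrite scalerA [r * _]mulrC -scalerA; congr (_ *: _).
by rewrite scalerDr scalerA rr scale1r addrC.
Qed.

Definition sandwich (r : C) (B D X : 'M[C]_n) : 'M[C]_n :=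
  B *m X *m D + r *: (D *m X *m B).

Lemma sandwichZ r B D c X : c *: sandwich r B D X = sandwich r B D (c *: X).
Proof.
rewrite /sandwich scalerDr !scalerA [c * r]mulrC -scalerA.
by rewrite -!scalemxAr -!scalemxAl.
Qed.

Lemma sandwichD r B D X Y :
  sandwich r B D X + sandwich r B D Y = sandwich r B D (X + Y).
Proof.
by rewrite /sandwich !mulmxDr !mulmxDl scalerDr [LHS]addrACA.
Qed.

Lemma mulmx_sandwich r B D X Y Z : Y *m sandwich r B D X *m Z =
  (Y *m B) *m X *m (D *m Z) + r *: ((Y *m D) *m X *m (B *m Z)).
Proof.
by rewrite /sandwich mulmxDr mulmxDl -scalemxAr -scalemxAl !mulmxA.
Qed.

Lemma sandwich_swap r B D X : r * r = 1 ->
  sandwich r D B X = r *: sandwich r B D X.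
Proof. by move=> rr; rewrite /sandwich scalerDr scalerA rr scale1r addrC. Qed.

(** The adjoint reverses each product and so exchanges [B] and [D]; exchanging them back costs a
    factor [r], which is moved onto the middle matrix. *)
Lemma sandwich_trmxC r B D X : r * r = 1 -> r^* = r -> B ^t* = B -> D ^t* = D ->
  (sandwich r B D X) ^t* = sandwich r B D (r *: X ^t*).
Proof.
move=> rr hr hB hD; rewrite -sandwichZ -sandwich_swap // /sandwich.
by rewrite trmxCD trmxCZ !trmxC_mul hB hD hr !mulmxA.
Qed.

(** [G] stands for [t |-> A^t]. Conjugation by [G u] produces the first product at [t + u] but the
    second product at [t - u]; conjugation by [G (- u)] produces the other two. *)
Lemma sandwich_shift (V : comPzRingType) (G : V -> 'M[C]_n) r X t u :
  (forall x y, G (x + y) = G x *m G y) ->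
  sandwich r (G (t + u)) (G (1 - (t + u))) X +
  sandwich r (G (t - u)) (G (1 - (t - u))) X =
  G u *m sandwich r (G t) (G (1 - t)) X *m G (- u) +
  G (- u) *m sandwich r (G t) (G (1 - t)) X *m G u.
Proof.
move=> GD; rewrite !mulmx_sandwich -!GD.
have -> : 1 - (t + u) = 1 - t - u by ring.
have -> : 1 - (t - u) = 1 - t + u by ring.
rewrite [u + t]addrC [u + (1 - t)]addrC [- u + t]addrC [- u + (1 - t)]addrC.
rewrite /sandwich addrACA [RHS]addrACA; congr (_ + _); exact: addrC.
Qed.

End ConjugateTranspose.

Local Open Scope complex_scope.

(** * Unitarily invariant norms: pinching and conjugation *)

Section UnitarilyInvariantNorm.
Context {R : realType} {n : nat} (N : 'M[R[i]]_n -> R).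
Hypotheses (normN : is_norm N) (invN : unitarily_invariant N).
Implicit Types (A B U X Y Z : 'M[R[i]]_n).

Lemma normD X Y : N (X + Y) <= N X + N Y.
Proof. by case: normN. Qed.

Lemma normZ (c : R) X : N (c%:C *: X) = `|c| * N X.
Proof.
case: normN => _ _ NZ _.
have /(congr1 (@complex.Re R)) := NZ c%:C X.
by rewrite normc_def /= mul0r subr0 expr0n addr0 sqrtr_sqr.
Qed.

Lemma norm_sum (I : finType) (F : I -> 'M[R[i]]_n) :
  N (\sum_i F i) <= \sum_i N (F i).
Proof.
apply: (big_ind2 (fun X x => N X <= x)) => // [|X x Y y hX hY].
  by rewrite -(scale0r (0 : 'M_n)) (normZ 0) normr0 mul0r.
by apply: le_trans (normD X Y) _; apply: lerD.
Qed.

Lemma norm_conj U X : U \is unitarymx -> N (U *m X *m U ^t*) = N X.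
Proof.
move=> hU.
have hV : U ^t* \is unitarymx by rewrite trmxC_unitary; exact: hU.
exact: (invN X hU hV).
Qed.

Definition sign_mx (k : 'I_n) : 'M[R[i]]_n :=
  diag_mx (\row_i (-1) ^+ (i == k)).

Lemma sign_mx_unitary k : sign_mx k \is unitarymx.
Proof.
apply/unitarymxP; rewrite tr_diag_mx map_diag_mx mulmx_diag -diag_const_mx.
congr diag_mx; apply/rowP => i; rewrite !mxE rmorphXn rmorphN1 -exprD addnn.
by rewrite -mul2n exprM sqrrN expr1n expr1n.
Qed.

(** The pinching of [X] to the blocks [{k}] and its complement, written as a mean of two unitary
    conjugates so that it cannot increase [N]. *)
Definition pinch k X := (2^-1)%:C *: (X + sign_mx k *m X *m sign_mx k).

Lemma pinchE k X i j :
  pinch k X i j = if (i == k) == (j == k) then X i j else 0.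
Proof.
rewrite mxE mxE /sign_mx mul_diag_mx mul_mx_diag !mxE.
have e2 : (2^-1)%:C + (2^-1)%:C = 1 :> R[i].
  have e : 2^-1 + 2^-1 = 1 :> R by lra.
  by rewrite -rmorphD /= e.
case: (i == k); case: (j == k); rewrite /= ?expr0 ?expr1.
- by rewrite mulN1r mulrN1 opprK mulrDr -mulrDl e2 mul1r.
- by rewrite mulN1r mulr1 subrr mulr0.
- by rewrite mul1r mulrN1 subrr mulr0.
- by rewrite mul1r mulr1 mulrDr -mulrDl e2 mul1r.
Qed.

Lemma norm_pinch k X : N (pinch k X) <= N X.
Proof.
rewrite normZ ger0_norm ?invr_ge0 // ler_pdivrMl //.
apply: le_trans (normD _ _) _.
by rewrite invN ?sign_mx_unitary //; lra.
Qed.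

(* Averaging over the diagonal sign matrices removes the off-diagonal part. *)
Lemma norm_diag X : N (diag_mx (\row_i X i i)) <= N X.
Proof.
have le_pinch s : N (foldr pinch X s) <= N X.
  by elim: s => //= k s; apply: le_trans; apply: norm_pinch.
suff -> : diag_mx (\row_i X i i) = foldr pinch X (enum 'I_n) by apply: le_pinch.
have pinchsE (s : seq 'I_n) i j : foldr pinch X s i j =
    if all (fun k => (i == k) == (j == k)) s then X i j else 0.
  by elim: s => //= k s IH; rewrite pinchE IH; case: eqP.
apply/matrixP => i j; rewrite pinchsE !mxE.
have [->|ij] := eqVneq i j.
  by rewrite mulr1n; case: allP => // -[] k _ /=.
(* The pinching at [k = i] already kills the entry [(i, j)]. *)
rewrite mulr0n; case: allP => // /(_ i); rewrite mem_enum => /(_ isT).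
by rewrite eqxx [j == i]eq_sym (negPf ij).
Qed.

(** Reordering a diagonal is conjugation by a permutation matrix, which is unitary. This absorbs the
    unknown order of the eigenvalues on a Schur diagonal. *)
Lemma norm_diag_perm (d e : 'rV[R[i]]_n) :
  perm_eq [seq d 0 i | i <- enum 'I_n] [seq e 0 i | i <- enum 'I_n] ->
  N (diag_mx d) = N (diag_mx e).
Proof.
move=> /(@tuple_permP _ _ _ [tuple e 0 i | i < n]) [s ds].
have dE i : d 0 i = e 0 (s i).
  have := congr1 (fun l => nth 0 l i) ds.
  rewrite (nth_map i) ?size_enum_ord // nth_ord_enum.
  rewrite (nth_map i) ?size_enum_ord // nth_ord_enum.
  by rewrite tnth_mktuple.
have us : (perm_mx s : 'M[R[i]]_n) \is unitarymx.
  apply/unitarymxP; rewrite tr_perm_mx map_perm_mx -perm_mxM mulgV.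
  exact: perm_mx1.
rewrite -(norm_conj (diag_mx e) us); congr N.
rewrite tr_perm_mx map_perm_mx -[perm_mx s *m _]row_permE -col_permE.
apply/matrixP => i j; rewrite !mxE dE (inj_eq perm_inj).
by rewrite ?invgK.
Qed.

Lemma hermsymmxE X : (X \is hermsymmx) = (X ^t* == X).
Proof. by rewrite qualifE expr0 scale1r eq_sym. Qed.

(* The Corach-Porta-Recht inequality. [Z = B Y B^-1] has the eigenvalues of [Y]
   on the diagonal of its Schur form, hence on the diagonal of the real part of
   that form. *)
Lemma norm_conj_sum_ge B Y : B \in unitmx -> B ^t* = B -> Y ^t* = Y ->
  2 * N Y <= N (B *m Y *m invmx B + invmx B *m Y *m B).
Proof.
move=> uB hB hY; set Z := B *m Y *m invmx B.
have hVB : (invmx B) ^t* = invmx B.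
  by rewrite matrix.trmx_inv map_invmx hB.
have -> : invmx B *m Y *m B = Z ^t*.
  by rewrite /Z !trmxC_mul hVB hB hY mulmxA.
(* Unitary triangularization of the commuting pair [(Z, Z)] is the Schur form of [Z]. *)
have [U hU] := cotrigonalization2 (erefl (Z *m Z)).
rewrite andbb /similar_to conjymx //; set T := U *m Z *m U ^t* => trigT.
have nY : Y \is normalmx by apply: hermitian_normalmx; rewrite hermsymmxE hY.
set d := spectral_diag Y; set P := spectralmx Y.
have hP : P \is unitarymx := spectral_unitarymx Y.
have YE : Y = P ^t* *m diag_mx d *m P.
  by rewrite [LHS](orthomx_spectralP nY) invmx_unitary.
have NY : N Y = N (diag_mx d).
  rewrite YE; apply: (invN _ _ hP).
  by rewrite trmxC_unitary; apply: hP.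
(* [T], [Z], [Y] and [diag_mx d] are similar, so the two products of linear factors agree and have
   the same roots with multiplicity. *)
have permTd : perm_eq [seq T i i | i <- enum 'I_n] [seq d 0 i | i <- enum 'I_n].
  apply: prod_XsubC_eq; rewrite big_map [RHS]big_map !big_enum /=.
  rewrite -char_poly_trig //.
  rewrite /T -invmx_unitary // char_poly_conj ?unitarymx_unit //.
  rewrite /Z char_poly_conj //.
  rewrite [in LHS]YE -invmx_unitary // -{2}(invmxK P).
  rewrite char_poly_conj ?unitmx_inv ?unitarymx_unit //.
  rewrite char_poly_trig ?diag_mx_is_trig //.
  by apply: eq_bigr => i _; rewrite !mxE eqxx mulr1n.
have realT i : (T i i)^*%R = T i i.
  have /mxOverP rd : d \is a realmx.
    by apply: hermitian_spectral_diag_real; rewrite hermsymmxE hY.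
  have : T i i \in [seq d 0 i | i <- enum 'I_n].
    by rewrite -(perm_mem permTd); apply: map_f; rewrite mem_enum.
  by move=> /mapP[j _ ->]; apply: CrealP.
have -> : N (Z + Z ^t*) = N (T + T ^t*).
  rewrite -(norm_conj _ hU) mulmxDr mulmxDl; congr N; congr (_ + _).
  by rewrite /T (trmxC_mul (U *m Z)) (trmxC_mul U Z) trmxCK mulmxA.
(* Passing to the diagonal of [T + T ^t*] does not increase [N]; since the [T i i] are real, this
   leaves [2 * N (diag_mx d) = 2 * N Y]. *)
clearbody T; apply: le_trans (norm_diag _).
have -> : diag_mx (\row_i (T + T ^t*) i i) = 2%:C *: diag_mx (\row_i T i i).
  rewrite -linearZ; congr diag_mx; apply/rowP => i.
  by rewrite !mxE realT rmorph_nat mulr_natl mulr2n.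
rewrite normZ ger0_norm // NY; apply/ler_wpM2l => //.
rewrite (@norm_diag_perm (\row_i T i i) d) //.
by under eq_map => i do rewrite mxE.
Qed.

End UnitarilyInvariantNorm.

(** [x ^ t] increases in [t] for [x >= 1] and decreases for [x <= 1]; the sum of the endpoint values
    dominates in both cases. *)
Lemma powR_le_add (R : realType) (x a b t : R) : 0 < x -> a <= t <= b ->
  x `^ t <= x `^ a + x `^ b.
Proof.
move=> x0 /andP[at_ tb].
have [x1|x1] := leP 1 x.
  by rewrite ler_wpDl ?powR_ge0 // ler_powR.
rewrite ler_wpDr ?powR_ge0 // /powR gt_eqF // ler_expR ler_wnM2r //.
by apply: ln_le0; apply: ltW.
Qed.

(** * Real powers of a positive definite matrix *)

Section Powers.
Context {R : realType} {n : nat} (A : 'M[R[i]]_n).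
Hypothesis posA : posdefmx A.

Let diagpow (d : 'I_n -> R) (t : R) : 'M[R[i]]_n :=
  diag_mx (\row_i (d i `^ t)%:C).

(** A single [P] and [d] diagonalize all powers at once, which reduces the laws of exponents to
    those of positive reals. *)
Lemma mxpowR_spectral : exists (P : 'M[R[i]]_n) (d : 'I_n -> R),
  [/\ P \is unitarymx, forall i, 0 < d i,
      A = P ^t* *m diagpow d 1 *m P
    & forall t, mxpowR A t = P ^t* *m diagpow d t *m P].
Proof.
have [hA pos] := posA; have hP := spectral_unitarymx A.
exists (spectralmx A), (fun i => complex.Re (spectral_diag A 0 i)).
have AE := orthomx_spectralP (hermitian_normalmx hA).
rewrite /mxpowR /herm_fun (invmx_unitary hP) in AE *.
move: (spectralmx A) (spectral_diag A) hP AE => P e hP AE.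
(* The eigenvalue is the quadratic form of [A] at its eigenvector, column [i] of [P ^t*], which is
   nonzero because it has unit length. *)
have e0 i : 0 < e 0 i.
  pose v := col i (P ^t*).
  have vE : v ^t* = row i P.
    by apply/matrixP => j k; rewrite !mxE conjCK.
  have PAP : P *m A *m P ^t* = diag_mx e.
    rewrite AE !mulmxA (unitarymxP hP) mul1mx -mulmxA.
    by rewrite (unitarymxP hP) mulmx1.
  have vAv : (v ^t* *m A *m v) 0 0 = e 0 i.
    rewrite vE /v -row_mul.
    have -> : e 0 i = diag_mx e i i by rewrite mxE eqxx mulr1n.
    by rewrite -PAP !mxE; apply: eq_bigr => k _; rewrite !mxE.
  have v0 : v != 0.
    apply/eqP => v0; have : (row i P *m v) 0 0 = (P *m P ^t*) i i.
      by rewrite /v !mxE; apply: eq_bigr => k _; rewrite !mxE.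
    rewrite v0 mulmx0 (unitarymxP hP) mxE [RHS]mxE eqxx => /esym/eqP.
    by rewrite oner_eq0.
  by rewrite -vAv; apply: pos.
(* Positivity in [R[i]] also forces a zero imaginary part, so the eigenvalue equals its real
   part. *)
have e0' i : 0 < complex.Re (e 0 i) by have := e0 i; rewrite ltcE => /andP[].
split; [exact: hP|exact: e0'| |move=> t].
  rewrite [LHS]AE; apply: (congr1 (fun x => P ^t* *m diag_mx x *m P)).
  apply/rowP => i.
  rewrite mxE powRr1 ?ltW //; have := e0 i; rewrite ltcE => /andP[/eqP im _].
  by apply/eqP; rewrite eq_complex /= im !eqxx.
apply: (congr1 (fun x => P ^t* *m diag_mx x *m P)).
by apply/rowP => i; rewrite !mxE.
Qed.

Lemma mxpowR_trmxC t : (mxpowR A t) ^t* = mxpowR A t.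
Proof.
have [P [d [_ _ _ ->]]] := mxpowR_spectral.
rewrite trmxC_conj; apply: (congr1 (fun X => P ^t* *m X *m P)).
rewrite /diagpow tr_diag_mx map_diag_mx; congr diag_mx; apply/rowP => i.
by rewrite !mxE; apply: conjc_real.
Qed.

Lemma mxpowRD s t : mxpowR A (s + t) = mxpowR A s *m mxpowR A t.
Proof.
have [P [d [hP d0 _ E]]] := mxpowR_spectral.
rewrite !E unitary_conjM; last exact: hP.
apply: (congr1 (fun X => P ^t* *m X *m P)).
rewrite /diagpow mulmx_diag; congr diag_mx; apply/rowP => i.
rewrite !mxE -rmorphM; congr (_%:C).
by apply: powRD; apply/implyP => _; apply: lt0r_neq0.
Qed.

Lemma mxpowR0 : mxpowR A 0 = 1%:M.
Proof.
have [P [d [hP d0 _ ->]]] := mxpowR_spectral.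
have -> : diagpow d 0 = 1%:M.
  by rewrite -diag_const_mx; congr diag_mx; apply/rowP => i; rewrite !mxE powRr0.
rewrite mulmx1 -(invmx_unitary hP); apply: mulVmx.
exact: unitarymx_unit hP.
Qed.

Lemma mxpowR1 : mxpowR A 1 = A.
Proof. by have [P [d [_ _ AE ->]]] := mxpowR_spectral. Qed.

Lemma mxpowR_unit t : mxpowR A t \in unitmx.
Proof.
have E : mxpowR A t *m mxpowR A (- t) = 1%:M.
  by rewrite -mxpowRD subrr mxpowR0.
exact: (proj1 (mulmx1_unit E)).
Qed.

Lemma mxpowRN t : mxpowR A (- t) = invmx (mxpowR A t).
Proof.
rewrite -[LHS](mulmxK (mxpowR_unit t)) -mxpowRD addNr mxpowR0.
exact: mul1mx.
Qed.

(** [A^t] is a combination of the fixed rank-one projections [Q i] with coefficients [d i ^ t],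
    bounded on [[a, b]]; the triangle inequality does the rest. This supplies the bound needed
    beside midpoint convexity. *)
Lemma norm_mxpowR_bounded (N : 'M[R[i]]_n -> R) X (a b : R) : is_norm N ->
  exists M, forall t s, a <= t <= b -> a <= s <= b ->
    N (mxpowR A t *m X *m mxpowR A s) <= M.
Proof.
move=> normN; have [P [d [_ d0 _ E]]] := mxpowR_spectral.
pose Q i : 'M[R[i]]_n := P ^t* *m delta_mx i i *m P.
have QE t : mxpowR A t = \sum_i (d i `^ t)%:C *: Q i.
  rewrite E /diagpow diag_mx_sum_delta mulmx_sumr mulmx_suml.
  by apply: eq_bigr => i _; rewrite mxE -scalemxAr -scalemxAl.
have N0 Y : 0 <= N Y by case: normN.
pose c i := d i `^ a + d i `^ b.
exists (\sum_i \sum_j c i * c j * N (Q i *m X *m Q j)) => t s tab sab.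
rewrite !QE !mulmx_suml; apply: le_trans (norm_sum normN _) _.
apply: ler_sum => i _; rewrite mulmx_sumr; apply: le_trans (norm_sum normN _) _.
apply: ler_sum => j _; rewrite -!scalemxAl -scalemxAr scalerA -rmorphM normZ //.
rewrite ger0_norm ?mulr_ge0 ?powR_ge0 // ler_wpM2r //.
by apply: ler_pM; rewrite ?powR_ge0 ?powR_le_add.
Qed.

End Powers.

(** * Monotonicity of the symmetrized products in the exponent *)

Section Heinz.
Context {R : realType} {n : nat}.
Implicit Types (A K X : 'M[R[i]]_n) (r s t u : R).

(** The sign is a real [r], later with [|r| = 1], so that one argument covers both cases. *)
Definition heinz_mx r A X t : 'M[R[i]]_n :=
  sandwich r%:C (mxpowR A t) (mxpowR A (1 - t)) X.

Lemma sign_sqr r : `|r| = 1 -> r%:C * r%:C = 1.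
Proof.
by move=> r1; rewrite -rmorphM -expr2 -real_normK ?num_real // r1 expr1n.
Qed.

(** Taking adjoints amounts to replacing the middle matrix by [r] times its adjoint, so the real
    part only averages middle matrices. The resulting [K] does not depend on [t], so different
    exponents can be compared at the same angle. *)
Lemma mxRe_heinz r A X t (c : R[i]) : posdefmx A -> `|r| = 1 ->
  let K := 2^-1 *: (c *: X + r%:C *: (c *: X) ^t*) in
  K ^t* = r%:C *: K /\ mxRe (c *: heinz_mx r A X t) = heinz_mx r A K t.
Proof.
move=> posA /sign_sqr rr.
have cr : (r%:C)^*%R = r%:C := conjc_real r.
move=> K; split; first exact: half_addZ_trmxC.
have hA := mxpowR_trmxC posA.
rewrite /mxRe /heinz_mx sandwichZ (sandwich_trmxC _ rr cr (hA _) (hA _)).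
by rewrite sandwichD sandwichZ.
Qed.

Section Norm.
Variables (N : 'M[R[i]]_n -> R) (A : 'M[R[i]]_n) (r : R).
Hypotheses (normN : is_norm N) (invN : unitarily_invariant N).
Hypotheses (posA : posdefmx A) (r1 : `|r| = 1).

Lemma heinz_trmxC K t : K ^t* = r%:C *: K ->
  (heinz_mx r A K t) ^t* = heinz_mx r A K t.
Proof.
move=> hK; have cr : (r%:C)^*%R = r%:C := conjc_real r.
have hA := mxpowR_trmxC posA.
rewrite /heinz_mx (sandwich_trmxC _ (sign_sqr r1) cr (hA _) (hA _)).
by rewrite hK scalerA (sign_sqr r1) scale1r.
Qed.

(** Replacing [t] by [1 - t] multiplies the matrix by [r], of modulus one. *)
Lemma norm_heinz_sym K t : N (heinz_mx r A K (1 - t)) = N (heinz_mx r A K t).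
Proof.
transitivity (N (r%:C *: heinz_mx r A K t)); last by rewrite normZ // r1 mul1r.
rewrite /heinz_mx subKr; apply: (congr1 N).
exact: (sandwich_swap _ _ _ (sign_sqr r1)).
Qed.

Lemma heinz_shift K t u : heinz_mx r A K (t + u) + heinz_mx r A K (t - u) =
  mxpowR A u *m heinz_mx r A K t *m mxpowR A (- u) +
  mxpowR A (- u) *m heinz_mx r A K t *m mxpowR A u.
Proof.
exact: (sandwich_shift (G := mxpowR A) r%:C K t u (mxpowRD posA)).
Qed.

Lemma norm_heinz_midconvex K t u : K ^t* = r%:C *: K ->
  2 * N (heinz_mx r A K t) <=
  N (heinz_mx r A K (t + u)) + N (heinz_mx r A K (t - u)).
Proof.
move=> hK; apply: le_trans (normD normN _ _).
rewrite heinz_shift mxpowRN //; apply: norm_conj_sum_ge => //.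
- exact: mxpowR_unit.
- exact: mxpowR_trmxC.
- exact: heinz_trmxC.
Qed.

Lemma norm_heinz_le K s t : K ^t* = r%:C *: K ->
  `|2 * s - 1| <= `|2 * t - 1| ->
  N (heinz_mx r A K s) <= N (heinz_mx r A K t).
Proof.
(* The substitution [x = 2 * t - 1] moves the centre of symmetry from [1/2] to [0]. *)
move=> hK st; pose g x := N (heinz_mx r A K ((1 + x) / 2)).
have gN x : g (- x) = g x.
  by rewrite /g -[RHS]norm_heinz_sym; congr (N (heinz_mx r A K _)); lra.
have gE x : N (heinz_mx r A K x) = g (2 * x - 1).
  by rewrite /g; congr (N (heinz_mx r A K _)); lra.
have gconv x u : 2 * g x <= g (x + u) + g (x - u).
  have := norm_heinz_midconvex ((1 + x) / 2) (u / 2) hK.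
  by rewrite /g -mulrDl -mulrBl !addrA.
set b := `|2 * t - 1| in st *.
(* This interval is the image of [[-b, b]] and is symmetric about [1/2], so it contains both
   exponents [t] and [1 - t]; [M] then bounds each of the two products. *)
have [M MP] := norm_mxpowR_bounded posA K ((1 - b) / 2) ((1 + b) / 2) normN.
have gM x : `|x| <= b -> g x <= M + M.
  rewrite ler_norml => /andP[x1 x2].
  apply: le_trans (normD normN _ _) _; rewrite (normZ normN) r1 mul1r.
  by apply: lerD; apply: MP; lra.
clearbody g.
suff : g (2 * s - 1) <= g (2 * t - 1)
  by rewrite -(gE s) -(gE t).
have -> : g (2 * t - 1) = g b.
  by rewrite /b; case: (ger0P (2 * t - 1)) => _ //; rewrite gN.
exact: (even_midconvex_le gN gconv gM).
Qed.

(** The inequality already holds angle by angle, each angle having its own [K], and passes to the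
    suprema. *)
Lemma gen_num_radius_heinz_le X s t :
  `|2 * s - 1| <= `|2 * t - 1| ->
  gen_num_radius N (heinz_mx r A X s) <= gen_num_radius N (heinz_mx r A X t).
Proof.
move=> st; apply: ge_sup.
  by case: (gen_num_radius_has_sup (heinz_mx r A X s) normN).
move=> _ [th _ <-].
have [hK KE] := mxRe_heinz X s (expi th) posA r1.
have [_ KE'] := mxRe_heinz X t (expi th) posA r1.
rewrite KE; apply: le_trans (norm_heinz_le hK st) _; rewrite -KE'.
apply: ub_le_sup; last by exists th.
by case: (gen_num_radius_has_sup (heinz_mx r A X t) normN).
Qed.

End Norm.
End Heinz.

Theorem mainTheorem7 (R : realType) (n : nat) (N : 'M[R[i]]_n -> R)
    (A X : 'M[R[i]]_n) (t : R) :
  is_norm N -> unitarily_invariant N -> posdefmx A ->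
  (t \in `[0, 1] ->
     gen_num_radius N (mxpowR A t *m X *m mxpowR A (1 - t) +
                       mxpowR A (1 - t) *m X *m mxpowR A t)
       <= gen_num_radius N (A *m X + X *m A) /\
     gen_num_radius N (mxpowR A t *m X *m mxpowR A (1 - t) -
                       mxpowR A (1 - t) *m X *m mxpowR A t)
       <= gen_num_radius N (A *m X - X *m A)) /\
  (t \notin `[0, 1] ->
     gen_num_radius N (mxpowR A t *m X *m mxpowR A (1 - t) +
                       mxpowR A (1 - t) *m X *m mxpowR A t)
       >= gen_num_radius N (A *m X + X *m A) /\
     gen_num_radius N (mxpowR A t *m X *m mxpowR A (1 - t) -
                       mxpowR A (1 - t) *m X *m mxpowR A t)
       >= gen_num_radius N (A *m X - X *m A)).
Proof.
move=> normN invN posA.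
have heinzp s : mxpowR A s *m X *m mxpowR A (1 - s) +
    mxpowR A (1 - s) *m X *m mxpowR A s = heinz_mx 1 A X s.
  by rewrite /heinz_mx /sandwich scale1r.
have heinzm s : mxpowR A s *m X *m mxpowR A (1 - s) -
    mxpowR A (1 - s) *m X *m mxpowR A s = heinz_mx (-1) A X s.
  by rewrite /heinz_mx /sandwich rmorphN1 scaleN1r.
(* The right-hand sides are the case of exponent [1], since [A^0] is the identity. *)
have h1p : A *m X + X *m A = heinz_mx 1 A X 1.
  by rewrite -heinzp (subrr (1 : R)) (mxpowR0 posA) (mxpowR1 posA) mulmx1 mul1mx.
have h1m : A *m X - X *m A = heinz_mx (-1) A X 1.
  by rewrite -heinzm (subrr (1 : R)) (mxpowR0 posA) (mxpowR1 posA) mulmx1 mul1mx.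
have n1 : `|1| = 1 :> R by rewrite normr1.
have nN1 : `|-1| = 1 :> R by rewrite normrN1.
have e1 : `|2 * 1 - 1| = 1 :> R by rewrite (_ : 2 * 1 - 1 = 1) ?normr1 //; lra.
(* [t] lies in [[0, 1]] exactly when [|2 * t - 1| <= 1], and [1] is the value of [|2 * t - 1|] at
   [t = 1]. *)
rewrite heinzp heinzm h1p h1m in_itv /=; split=> [/andP[t0 t1]|].
  have ht : `|2 * t - 1| <= `|2 * 1 - 1| by rewrite e1 ler_norml; lra.
  by split; apply: gen_num_radius_heinz_le.
move=> nt; have ht : `|2 * 1 - 1| <= `|2 * t - 1|.
  rewrite e1 leNgt; apply: contra nt; rewrite ltr_norml; lra.
by split; apply: gen_num_radius_heinz_le.
Qed.
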